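(* Let $A$ be a commutative ring with $\mathrm{Hdim}\,A<k$, and let $M$ be a finitely generated projective $A$-module of rank $\ge k$. Then $M\simeq N\oplus A$ for some $A$-module $N$.
   Context: For a commutative ring $A$, let $\mathrm{J}_A(0)=\{x\in A:\forall y\in A,\ 1+xy \text{ is invertible}\}$ be its Jacobson radical, and for $x\in A$ let $\mathrm{H}_A(x)=xA+(\mathrm{J}_A(0):x)$ (Heitmann boundary ideal), where $(\mathrm{J}_A(0):x)=\{b\in A: bx\in \mathrm{J}_A(0)\}$. The Heitmann dimension is defined inductively: $\mathrm{Hdim}\,A\le -1$ iff $1=0$ in $A$; for $\ell\ge 0$, $\mathrm{Hdim}\,A\le \ell$ iff $\mathrm{Hdim}(A/\mathrm{H}_A(x))\le\ell-1$ for all $x\in A$. $\mathrm{Hdim}\,A<k$ means $\mathrm{Hdim}\,A\le k-1$. A finitely generated projective module $M$ has rank $\ge k$ if its rank at every prime ideal is $\ge k$; equivalently, if $F$ is an idempotent matrix with image isomorphic to $M$, the minors of order $k$ of $F$ generate the unit ideal. No noetherian hypothesis is made. *)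

(* Defs.v *)
From HB Require Import structures.
From mathcomp Require Import all_boot all_algebra.
From mathcomp Require Import ring.
From mathcomp Require Import boolp classical_sets.

Set Implicit Arguments.
Unset Strict Implicit.
Unset Printing Implicit Defensive.

Import GRing.Theory.
Local Open Scope ring_scope.
Local Open Scope quotient_scope.

(* Rings are [comPzRingType]s: the trivial ring must be allowed, both for
   Hdim A <= -1 and because the quotients A / H_A(x) may vanish. Ideals are
   arbitrary [Prop]-valued predicates, made boolean by classical logic in order
   to form quotient types. *)

Record ideal (A : comPzRingType) := Ideal {
  ideal_set :> A -> Prop;
  ideal0 : ideal_set 0;
  idealD : forall x y, ideal_set x -> ideal_set y -> ideal_set (x + y);
  idealM : forall a x, ideal_set x -> ideal_set (a * x)
}.

Section QuotientRing.
Variables (A : comPzRingType) (I : ideal A).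

Definition ideal_pred : A -> bool := fun x => `[< I x >].

Lemma ideal_pred_zmod_closed : zmod_closed ideal_pred.
Proof.
split=> [|x y /asboolP Ix /asboolP Iy]; first by apply/asboolP/ideal0.
by apply/asboolP; apply: idealD => //; rewrite -mulN1r; apply: idealM.
Qed.

HB.instance Definition _ :=
  GRing.isZmodClosed.Build A ideal_pred ideal_pred_zmod_closed.

(* The library only makes a ring out of [Quotient.quot J] when J is proper;
   the additive group is reused and the ring structure is added here. *)
Definition quotient_ring : Type :=
  @Quotient.quot A (GRing.ZmodClosed.clone A ideal_pred _).

HB.instance Definition _ := EqQuotient.on quotient_ring.
HB.instance Definition _ := GRing.Zmodule.on quotient_ring.

Definition quotient_pi (x : A) : quotient_ring := \pi_(quotient_ring) x.

Lemma quotient_piP x y : quotient_pi x = quotient_pi y <-> I (x - y).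
Proof.
rewrite /quotient_pi; split=> [/eqP|H].
  by rewrite -Quotient.idealrBE => /asboolP.
by apply/eqP; rewrite -Quotient.idealrBE; apply/asboolP.
Qed.

Lemma quotient_piD : {morph quotient_pi : x y / x + y}.
Proof. by move=> x y; rewrite /quotient_pi Quotient.pi_add. Qed.

Lemma quotient_piK : cancel repr quotient_pi.
Proof. exact: reprK. Qed.

Definition quotient_one : quotient_ring := quotient_pi 1.
Definition quotient_mul (x y : quotient_ring) : quotient_ring :=
  quotient_pi (repr x * repr y).

Lemma quotient_piM x y :
  quotient_pi (x * y) = quotient_mul (quotient_pi x) (quotient_pi y).
Proof.
apply/quotient_piP; set x' := repr _; set y' := repr _.
have Hx : I (x - x') by apply/quotient_piP; rewrite quotient_piK.
have Hy : I (y - y') by apply/quotient_piP; rewrite quotient_piK.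
have -> : x * y - x' * y' = y * (x - x') + x' * (y - y').
  by rewrite !mulrBr [y * x]mulrC [y * x']mulrC addrA subrK.
by apply: idealD; apply: idealM.
Qed.

Lemma quotient_mulA : associative quotient_mul.
Proof.
move=> x y z; rewrite -[x]quotient_piK -[y]quotient_piK -[z]quotient_piK.
by rewrite -!quotient_piM mulrA.
Qed.

Lemma quotient_mulC : commutative quotient_mul.
Proof. by move=> x y; rewrite /quotient_mul mulrC. Qed.

Lemma quotient_mul1 : left_id quotient_one quotient_mul.
Proof. by move=> x; rewrite -[x]quotient_piK -quotient_piM mul1r. Qed.

Lemma quotient_mulDl : left_distributive quotient_mul +%R.
Proof.
move=> x y z; rewrite -[x]quotient_piK -[y]quotient_piK -[z]quotient_piK.
by rewrite -quotient_piD -!quotient_piM -quotient_piD mulrDl.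
Qed.

HB.instance Definition _ := GRing.Zmodule_isComPzRing.Build quotient_ring
  quotient_mulA quotient_mulC quotient_mul1 quotient_mulDl.

Lemma quotient_pi_zmod_morphism : zmod_morphism quotient_pi.
Proof.
by move=> x y; apply: (addIr (quotient_pi y)); rewrite -quotient_piD !subrK.
Qed.

Lemma quotient_pi_monoid_morphism : monoid_morphism quotient_pi.
Proof. by split=> // x y; apply: quotient_piM. Qed.

HB.instance Definition _ :=
  GRing.isZmodMorphism.Build A quotient_ring quotient_pi
    quotient_pi_zmod_morphism.
HB.instance Definition _ :=
  GRing.isMonoidMorphism.Build A quotient_ring quotient_pi
    quotient_pi_monoid_morphism.

End QuotientRing.

Definition invertible (A : comPzRingType) (x : A) := exists y, x * y = 1.

Section HeitmannBoundary.
Variable A : comPzRingType.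

Definition jacobson_set : set A := [set x | forall y, invertible (1 + x * y)].

Lemma jacobson0 : jacobson_set 0.
Proof. by move=> y; exists 1; rewrite mul0r addr0 mulr1. Qed.

Lemma jacobsonD x y :
  jacobson_set x -> jacobson_set y -> jacobson_set (x + y).
Proof.
move=> Jx Jy z; have [u xu] := Jx z; have [v yv] := Jy (z * u).
exists (u * v); rewrite [(x + y) * z]mulrDl mulrA addrA.
rewrite [(_ + y * z) * u]mulrDl xu.
by rewrite -[y * z * u]mulrA.
Qed.

Lemma jacobsonM a x : jacobson_set x -> jacobson_set (a * x).
Proof. by move=> Jx y; rewrite [a * x]mulrC -mulrA. Qed.

Definition jacobson : ideal A := Ideal jacobson0 jacobsonD jacobsonM.

Definition heitmann_set (x : A) : set A :=
  [set z | exists a b, jacobson (b * x) /\ z = x * a + b].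

Lemma heitmann0 x : heitmann_set x 0.
Proof.
by exists 0, 0; split; rewrite ?mulr0 ?addr0// mul0r; apply: jacobson0.
Qed.

Lemma heitmannD x y z :
  heitmann_set x y -> heitmann_set x z -> heitmann_set x (y + z).
Proof.
move=> [a [b [Jb ->]]] [a' [b' [Jb' ->]]]; exists (a + a'), (b + b').
by split; [rewrite mulrDl; apply: jacobsonD | rewrite mulrDr addrACA].
Qed.

Lemma heitmannM x c z : heitmann_set x z -> heitmann_set x (c * z).
Proof.
move=> [a [b [Jb ->]]]; exists (c * a), (c * b).
by split; [rewrite -mulrA; apply: jacobsonM | rewrite mulrDr mulrCA].
Qed.

Definition heitmann (x : A) : ideal A :=
  Ideal (@heitmann0 x) (@heitmannD x) (@heitmannM x).

End HeitmannBoundary.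

(* [Hdim_lt A k] is Hdim A < k, i.e. Hdim A <= k - 1; the shift by one lets
   the induction starting at -1 run over [nat]. *)
Fixpoint Hdim_lt (A : comPzRingType) (k : nat) {struct k} : Prop :=
  match k with
  | 0 => 1 = 0 :> A
  | l.+1 => forall x : A, Hdim_lt (quotient_ring (heitmann x)) l
  end.

Record prime_ideal (A : comPzRingType) := PrimeIdeal {
  prime_ideal_ideal :> ideal A;
  prime_ideal1 : ~ prime_ideal_ideal 1;
  prime_idealM : forall x y, prime_ideal_ideal (x * y) ->
    prime_ideal_ideal x \/ prime_ideal_ideal y
}.

Section Localization.
Variables (A : comPzRingType) (p : prime_ideal A).

Definition denom : Type := {s : A | `[< ~ p s >]}.
HB.instance Definition _ := Choice.on denom.

Definition mk_denom (s : A) (ps : ~ p s) : denom :=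
  @exist A (fun s => `[< ~ p s >]) s (asboolT ps).

Definition den (s : denom) : A := sval s.
Arguments den : simpl never.

Lemma denomP (s : denom) : ~ p (den s).
Proof. by case: s => s ps; apply/asboolP. Qed.

Definition denom1 : denom := mk_denom (@prime_ideal1 A p).

Lemma denomM_subproof (s t : denom) : ~ p (den s * den t).
Proof. by move=> /prime_idealM[]; apply: denomP. Qed.

Definition denomM (s t : denom) : denom := mk_denom (@denomM_subproof s t).

Lemma denM s t : den (denomM s t) = den s * den t. Proof. by []. Qed.
Lemma den1 : den denom1 = 1. Proof. by []. Qed.

Section LocalizedGroup.
Variable M : lmodType A.

Definition loc_frac_eq (x y : M * denom) : bool :=
  `[< exists u : denom,
      den u *: (den y.2 *: x.1) = den u *: (den x.2 *: y.1) >].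

Lemma loc_frac_eq_equiv : equiv_class_of loc_frac_eq.
Proof.
split=> [x|x y|y x z].
- by apply/asboolP; exists denom1.
- by apply/asboolP/asboolP => -[u Hu]; exists u.
move=> /asboolP[u Hu] /asboolP[v Hv]; apply/asboolP.
exists (denomM (denomM u v) y.2); rewrite !denM; rewrite !scalerA in Hu Hv *.
have -> : den u * den v * den y.2 * den z.2
          = den v * den z.2 * (den u * den y.2) by ring.
have -> : den u * den v * den y.2 * den x.2
          = den u * den x.2 * (den v * den y.2) by ring.
by rewrite -scalerA Hu scalerA [X in X *: y.1]mulrC -[LHS]scalerA Hv scalerA.
Qed.

Canonical loc_frac_eq_equiv_rel := EquivRelPack loc_frac_eq_equiv.
Canonical loc_frac_eq_encModRel := defaultEncModRel loc_frac_eq.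

Definition localized : Type := {eq_quot loc_frac_eq}.
HB.instance Definition _ := EqQuotient.on localized.
HB.instance Definition _ := Choice.on localized.

Definition loc_frac (x : M) (s : denom) : localized := \pi_localized (x, s).

Lemma loc_fracP x s y t : loc_frac x s = loc_frac y t <->
  exists u : denom, den u *: (den t *: x) = den u *: (den s *: y).
Proof.
rewrite /loc_frac; split=> [/eqP|H]; first by rewrite piE => /asboolP.
by apply/eqP; rewrite piE; apply/asboolP.
Qed.

Lemma loc_frac_repr (z : localized) : loc_frac (repr z).1 (repr z).2 = z.
Proof. by rewrite /loc_frac -surjective_pairing reprK. Qed.

Lemma loc_fracW (P : localized -> Prop) : (forall x s, P (loc_frac x s)) ->
  forall z, P z.
Proof. by move=> H z; rewrite -[z]loc_frac_repr. Qed.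

Definition loc_zero : localized := loc_frac 0 denom1.
Definition loc_opp (z : localized) : localized :=
  loc_frac (- (repr z).1) (repr z).2.
Definition loc_add (z w : localized) : localized :=
  loc_frac (den (repr w).2 *: (repr z).1 + den (repr z).2 *: (repr w).1)
       (denomM (repr z).2 (repr w).2).

Lemma loc_frac_opp x s : loc_opp (loc_frac x s) = loc_frac (- x) s.
Proof.
have /loc_fracP[u Hu] := loc_frac_repr (loc_frac x s).
by apply/loc_fracP; exists u; rewrite !scalerN Hu.
Qed.

Lemma loc_frac_add x s y t : loc_add (loc_frac x s) (loc_frac y t) =
  loc_frac (den t *: x + den s *: y) (denomM s t).
Proof.
have /loc_fracP[u Hu] := loc_frac_repr (loc_frac x s).
have /loc_fracP[v Hv] := loc_frac_repr (loc_frac y t).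
rewrite /loc_add; apply/loc_fracP; exists (denomM u v); rewrite /= ?denM.
move: (repr _) Hu => [x' s'] /=; move: (repr _) Hv => [y' t'] /=.
rewrite !scalerDr !scalerA => Hv Hu; rewrite ?scalerA in Hu Hv *; congr (_ + _).
  rewrite [X in X *: x'](_ : _ = den v * den t * den t' * (den u * den s));
    last by ring.
  by rewrite -[LHS]scalerA Hu scalerA; congr (_ *: _); ring.
rewrite [X in X *: y'](_ : _ = den u * den s * den s' * (den v * den t));
  last by ring.
by rewrite -[LHS]scalerA Hv scalerA; congr (_ *: _); ring.
Qed.

Lemma loc_addA : associative loc_add.
Proof.
elim/loc_fracW=> x s; elim/loc_fracW=> y t; elim/loc_fracW=> z r.
rewrite !loc_frac_add.
apply/loc_fracP; exists denom1;
  rewrite /= ?denM ?den1; congr (_ *: _).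
by rewrite !scalerDr !scalerA addrA; congr (_ *: _ + _ *: _ + _ *: _); ring.
Qed.

Lemma loc_addC : commutative loc_add.
Proof.
elim/loc_fracW=> x s; elim/loc_fracW=> y t; rewrite !loc_frac_add.
apply/loc_fracP; exists denom1;
  rewrite /= ?denM ?den1; congr (_ *: _).
by rewrite [den s * _]mulrC addrC.
Qed.

Lemma loc_add0 : left_id loc_zero loc_add.
Proof.
elim/loc_fracW=> x s; rewrite loc_frac_add; apply/loc_fracP; exists denom1;
  rewrite /= ?denM ?den1.
by rewrite scaler0 add0r mul1r !scale1r.
Qed.

Lemma loc_addN : left_inverse loc_zero loc_opp loc_add.
Proof.
elim/loc_fracW=> x s; rewrite loc_frac_opp loc_frac_add.
apply/loc_fracP; exists denom1; rewrite /= ?denM ?den1.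
by rewrite scalerN addNr !scaler0.
Qed.

HB.instance Definition _ := GRing.isZmodule.Build localized
  loc_addA loc_addC loc_add0 loc_addN.

Lemma loc_fracD x s y t :
  loc_frac x s + loc_frac y t = loc_frac (den t *: x + den s *: y) (denomM s t).
Proof. exact: loc_frac_add. Qed.

End LocalizedGroup.

(* The action (a / s) (x / t) = (a x) / (s t) of A_p on M_p; for M = A it is
   the multiplication of A_p. *)
Definition loc_act (M : lmodType A) (z : localized A^o) (w : localized M) :
    localized M :=
  loc_frac (((repr z).1 : A) *: (repr w).1) (denomM (repr z).2 (repr w).2).

Lemma loc_frac_act (M : lmodType A) (a : A) s (x : M) t :
  loc_act (@loc_frac A^o a s) (loc_frac x t) = loc_frac (a *: x) (denomM s t).
Proof.
have /loc_fracP[u Hu] := loc_frac_repr (@loc_frac A^o a s).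
have /loc_fracP[v Hv] := loc_frac_repr (loc_frac x t).
rewrite /loc_act; apply/loc_fracP; exists (denomM u v); rewrite /= ?denM.
move: (repr _) Hu => [b s'] /= Hu; move: (repr _) Hv => [y t'] /= Hv.
have {}Hu : den u * (den s * b) = den u * (den s' * a) := Hu.
rewrite !scalerA in Hv *.
rewrite (_ : _ * b = den u * (den s * b) * (den v * den t)); last ring.
by rewrite -scalerA Hv scalerA Hu; congr (_ *: _); ring.
Qed.

Lemma loc_actA (M : lmodType A) (a b : localized A^o) (x : localized M) :
  loc_act a (loc_act b x) = loc_act (loc_act a b) x.
Proof.
elim/loc_fracW: a => a s; elim/loc_fracW: b => b t; elim/loc_fracW: x => x r.
rewrite !loc_frac_act; apply/loc_fracP; exists denom1;
  rewrite /= ?denM ?den1; rewrite !scalerA.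
by congr (_ *: _); rewrite /GRing.scale /=; ring.
Qed.

Lemma loc_act1 (M : lmodType A) (x : localized M) :
  loc_act (@loc_frac A^o (1 : A) denom1) x = x.
Proof.
elim/loc_fracW: x => x r; rewrite loc_frac_act; apply/loc_fracP; exists denom1;
  rewrite /= ?denM ?den1.
by rewrite mul1r !scale1r.
Qed.

Lemma loc_actDr (M : lmodType A) (a : localized A^o) :
  {morph @loc_act M a : x y / x + y}.
Proof.
elim/loc_fracW: a => a s; elim/loc_fracW=> x t; elim/loc_fracW=> y r.
rewrite loc_fracD !loc_frac_act loc_fracD; apply/loc_fracP; exists denom1;
  rewrite /= ?denM ?den1.
rewrite !scalerDr !scalerA.
by congr (_ *: _ + _ *: _); ring.
Qed.

Lemma loc_actDl (M : lmodType A) (x : localized M) :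
  {morph (@loc_act M)^~ x : a b / a + b}.
Proof.
move=> a b; elim/loc_fracW: a => a s.
elim/loc_fracW: b => b t; elim/loc_fracW: x => x r.
rewrite loc_fracD.
rewrite (_ : den t *: a + den s *: b = (den t * a + den s * b : A)) //.
rewrite !loc_frac_act loc_fracD; apply/loc_fracP; exists denom1; rewrite !denM.
by rewrite scalerDl !scalerDr !scalerA; congr (_ *: _ + _ *: _); ring.
Qed.

Definition loc_ring : Type := localized A^o.
HB.instance Definition _ := GRing.Zmodule.on loc_ring.

Definition loc_one : loc_ring := @loc_frac A^o (1 : A) denom1.
Definition loc_mul (x y : loc_ring) : loc_ring := @loc_act A^o x y.

Lemma loc_mulA : associative loc_mul.
Proof. exact: (@loc_actA A^o). Qed.

Lemma loc_mulC : commutative loc_mul.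
Proof.
elim/loc_fracW=> x s; elim/loc_fracW=> y t; rewrite /loc_mul !loc_frac_act.
apply/loc_fracP; exists denom1; rewrite !denM den1 !scale1r.
by congr (_ * _); exact: mulrC.
Qed.

Lemma loc_mul1 : left_id loc_one loc_mul.
Proof. exact: (@loc_act1 A^o). Qed.

Lemma loc_mulDl : left_distributive loc_mul +%R.
Proof. by move=> a b x; apply: (@loc_actDl A^o). Qed.

HB.instance Definition _ := GRing.Zmodule_isComPzRing.Build loc_ring
  loc_mulA loc_mulC loc_mul1 loc_mulDl.

HB.instance Definition _ (M : lmodType A) :=
  GRing.Zmodule_isLmodule.Build loc_ring (localized M)
    (@loc_actA M) (@loc_act1 M) (@loc_actDr M) (@loc_actDl M).

End Localization.

Definition free_of_rank (R : comPzRingType) (M : lmodType R) (r : nat) : Prop :=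
  exists f : {linear 'rV[R]_r -> M}, bijective f.

Definition has_rank_at (A : comPzRingType) (p : prime_ideal A) (M : lmodType A)
    (r : nat) : Prop :=
  @free_of_rank (loc_ring p) (localized p M) r.

(* For M finitely generated projective the rank at p exists and is unique. *)
Definition rank_ge (A : comPzRingType) (M : lmodType A) (k : nat) : Prop :=
  forall p : prime_ideal A, exists2 r, has_rank_at p M r & (k <= r)%N.

Definition finitely_generated (A : comPzRingType) (M : lmodType A) : Prop :=
  exists (n : nat) (g : 'I_n -> M),
    forall m : M, exists c : 'I_n -> A, m = \sum_(i < n) c i *: g i.

Definition projective (A : comPzRingType) (M : lmodType A) : Prop :=
  forall (U V : lmodType A) (f : {linear U -> V}) (g : {linear M -> V}),
    (forall v, exists u, f u = v) ->
    exists h : {linear M -> U}, forall m, f (h m) = g m.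

Definition lmod_iso (A : comPzRingType) (M N : lmodType A) : Prop :=
  exists f : {linear M -> N}, bijective f.

(* Main.v *)
Require Import Defs.
From HB Require Import structures.
From mathcomp Require Import all_boot all_algebra.
From mathcomp Require Import ring.
From mathcomp Require Import boolp classical_sets.

Set Implicit Arguments.
Unset Strict Implicit.
Unset Printing Implicit Defensive.

Import GRing.Theory.
Local Open Scope ring_scope.

(** Write M* for the linear forms on M.  It is enough to find m in M and f in M*
    with f m = 1, since then M is the direct sum of ker f and A m
    ([split_off]).

    Say that a scalar w is good when w times the identity of A^k factors through
    M ([scalar_factors]): there are n_i in M and g_i in M* with g_i (n_j) = w if
    i = j and 0 otherwise.  At a prime p, M_p is free of rank at least k, and
    clearing denominators in a basis of M_p and in the dual basis gives a good w
    outside p ([scalar_factors_localized]).  Multiples of good scalars are good,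
    so the sums of good scalars form an ideal; no prime contains it, and
    therefore 1 is a sum w_1 + ... + w_r of good scalars.

    The w's are then removed one at a time.  Suppose that m, f and a satisfy
    f m + a w = 1 modulo an ideal I, with w good, and put
    m' = m + w (x_1 n_1 + ... + x_k n_k).  The values at m' of the forms on M
    make up an ideal modulo I which contains both g_i (m) + w^2 x_i, for every
    i, and f m', which is 1 - w (a - sum of x_i f (n_i)) modulo I.  So it is
    enough to choose x such that these k + 1 elements generate the unit ideal
    modulo I.  This is the stable range statement [Hdim_lt_shift], applied to
    A / I, whose dimension is still < k because quotients do not raise it
    ([Hdim_lt_quotient]).

    The stable range statement, for elements u_i + d^2 x_i and
    1 - d (t + sum of l_i x_i), is proved by induction on k.  Let v be the first
    of the u_i.  The induction hypothesis in A / H(v) gives the other x_i, and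
    an equation 1 = g + v a + b where b v lies in the Jacobson radical and g is
    generated by the other u_i + d^2 x_i and by q = 1 - d t', where t' is t plus
    the sum of the other l_i x_i.  Then the first x_i can be taken equal to b.
    Indeed, suppose that all the elements vanish, modulo an ideal, and compute
    modulo the Jacobson radical, where squares can only vanish trivially.  From
    v = - d^2 b and b v = 0, one gets v^2 = 0 and (d b)^2 = 0, so v = d b = 0.
    So q, which is a multiple of d b, vanishes, and g with it.  Now
    b = t' d b + q b = 0, and 1 = g + v a + b = 0. *)

(** * Ideals and the Jacobson radical *)

Section Ideals.
Variable A : comPzRingType.
Implicit Types I J K : ideal A.

Lemma idealMr I a x : I x -> I (x * a).
Proof. by move=> Ix; rewrite mulrC; apply: idealM. Qed.

Lemma idealN I x : I x -> I (- x).
Proof. by move=> Ix; rewrite -mulN1r; apply: idealM. Qed.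

Lemma idealB I x y : I x -> I y -> I (x - y).
Proof. by move=> Ix Iy; apply: idealD => //; apply: idealN. Qed.

Section Sum.
Variables I J : ideal A.
Let S (x : A) := exists2 y, I y & J (x - y).

Let S0 : S 0.
Proof. by exists 0; rewrite ?subr0; apply: ideal0. Qed.

Let SD x y : S x -> S y -> S (x + y).
Proof.
move=> [x' Ix Jx] [y' Iy Jy]; exists (x' + y'); first exact: idealD.
by rewrite opprD addrACA; apply: idealD.
Qed.

Let SM a x : S x -> S (a * x).
Proof.
by move=> [x' Ix Jx]; exists (a * x'); rewrite -?mulrBr; apply: idealM.
Qed.

Definition ideal_sum : ideal A := Ideal S0 SD SM.

Lemma ideal_sumWl x : I x -> ideal_sum x.
Proof. by move=> Ix; exists x; rewrite ?subrr //; apply: ideal0. Qed.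

Lemma ideal_sumWr x : J x -> ideal_sum x.
Proof. by move=> Jx; exists 0; rewrite ?subr0 //; apply: ideal0. Qed.

End Sum.

Section Principal.
Variable g : A.
Let S (x : A) := exists a, x = a * g.
Let S0 : S 0. Proof. by exists 0; rewrite mul0r. Qed.
Let SD x y : S x -> S y -> S (x + y).
Proof. by move=> [a ->] [b ->]; exists (a + b); rewrite mulrDl. Qed.
Let SM a x : S x -> S (a * x).
Proof. by move=> [b ->]; exists (a * b); rewrite mulrA. Qed.

Definition principal : ideal A := Ideal S0 SD SM.

Lemma principal_gen : principal g.
Proof. by exists 1; rewrite mul1r. Qed.
End Principal.

Section Generated.
Variable G : A -> Prop.
Let S (x : A) := forall I, (forall g, G g -> I g) -> I x.

Let S0 : S 0. Proof. by move=> I _; apply: ideal0. Qed.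
Let SD x y : S x -> S y -> S (x + y).
Proof. by move=> Sx Sy I GI; apply: idealD; [apply: Sx|apply: Sy]. Qed.
Let SM a x : S x -> S (a * x).
Proof. by move=> Sx I GI; apply/idealM/Sx. Qed.

Definition generated : ideal A := Ideal S0 SD SM.

Lemma generatedW x : G x -> generated x.
Proof. by move=> Gx I; apply. Qed.

End Generated.

Section Quotient.
Variable I : ideal A.
Notation pi := (@quotient_pi A I).

Section Image.
Variable K : ideal A.
Let S (y : quotient_ring I) := exists2 x, K x & y = pi x.

Let S0 : S 0. Proof. by exists 0; rewrite ?raddf0 //; apply: ideal0. Qed.
Let SD x y : S x -> S y -> S (x + y).
Proof.
move=> [x' Kx ->] [y' Ky ->]; exists (x' + y'); rewrite ?raddfD //.
exact: idealD.
Qed.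
Let SM a x : S x -> S (a * x).
Proof.
move=> [x' Kx ->]; exists (repr a * x'); first exact: idealM.
by rewrite rmorphM /= quotient_piK.
Qed.

Definition ideal_image : ideal (quotient_ring I) := Ideal S0 SD SM.
End Image.

Section Preimage.
Variable K : ideal (quotient_ring I).
Let S (x : A) := K (pi x).
Let S0 : S 0. Proof. by rewrite /S raddf0; apply: ideal0. Qed.
Let SD x y : S x -> S y -> S (x + y).
Proof. by rewrite /S raddfD; apply: idealD. Qed.
Let SM a x : S x -> S (a * x).
Proof. by rewrite /S rmorphM; apply: idealM. Qed.
Definition ideal_preimage : ideal A := Ideal S0 SD SM.
End Preimage.

Lemma quotient_pi_eq0 x : pi x = 0 <-> I x.
Proof. by rewrite -(raddf0 pi) quotient_piP subr0. Qed.

End Quotient.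

(** 1 - (x y)^2 = (1 - x y) (1 + x y). *)
Lemma jacobson_sqr x : jacobson A (x * x) -> jacobson A x.
Proof.
move=> Jx y; have [z H] := Jx (- (y * y)).
by exists ((1 - x * y) * z); rewrite -[RHS]H; ring.
Qed.

Lemma jacobson1 : jacobson A 1 -> 1 = 0 :> A.
Proof. by case/(_ (-1)) => z <-; ring. Qed.

End Ideals.

(** * Heitmann dimension and quotients *)

Lemma jacobson_surj (A B : comPzRingType) (f : {rmorphism A -> B}) :
  (forall y, exists x, f x = y) -> forall x, jacobson A x -> jacobson B (f x).
Proof.
move=> fS x Jx y; have [y' <-] := fS y; have [z xz] := Jx y'.
by exists (f z); rewrite -rmorphM -[1](rmorph1 f) -raddfD -rmorphM xz.
Qed.

Lemma quotient_pi_surj (A : comPzRingType) (I : ideal A) y :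
  exists x, quotient_pi I x = y.
Proof. by exists (repr y); rewrite quotient_piK. Qed.

(** A surjection maps the Jacobson radical into the Jacobson radical, hence
    boundary ideals into boundary ideals, so it induces surjections between the
    quotients that the definition of the dimension inspects. *)
Lemma Hdim_lt_surj k (A B : comPzRingType) (f : {rmorphism A -> B}) :
  (forall y, exists x, f x = y) -> Hdim_lt A k -> Hdim_lt B k.
Proof.
elim: k A B f => [|k IH] A B f fS /=.
  by move=> A0; rewrite -(rmorph1 f) A0 raddf0.
move=> HA x; have [x' fx] := fS x.
have fH y : heitmann x' y -> heitmann x (f y).
  move=> [a [b [Jb ->]]]; exists (f a), (f b); rewrite -fx -!rmorphM.
  by split; [apply: jacobson_surj Jb | rewrite raddfD].
pose g (y : quotient_ring (heitmann x')) :=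
  quotient_pi (heitmann x) (f (repr y)).
have gE y : g (quotient_pi _ y) = quotient_pi _ (f y).
  apply/quotient_piP; rewrite -raddfB; apply/fH/quotient_piP.
  by rewrite quotient_piK.
have gB : zmod_morphism g.
  move=> y z; rewrite -[y]quotient_piK -[z]quotient_piK -raddfB !gE raddfB.
  exact: raddfB.
have gM : monoid_morphism g.
  split=> [|y z]; first by rewrite -(rmorph1 (quotient_pi _)) gE !rmorph1.
  by rewrite -[y]quotient_piK -[z]quotient_piK -rmorphM !gE !rmorphM.
pose g' : {rmorphism _ -> _} :=
  HB.pack g (GRing.isZmodMorphism.Build _ _ g gB)
    (GRing.isMonoidMorphism.Build _ _ g gM).
apply: (IH _ _ g' _ (HA x')) => y.
have [z fz] := fS (repr y).
by exists (quotient_pi _ z); rewrite /= gE fz quotient_piK.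
Qed.

Lemma Hdim_lt_quotient k (A : comPzRingType) (I : ideal A) :
  Hdim_lt A k -> Hdim_lt (quotient_ring I) k.
Proof. exact/(@Hdim_lt_surj k _ _ (quotient_pi I))/quotient_pi_surj. Qed.

(** * Stable range *)

(** For every u, l, d, t there is x such that the elements u_i + d^2 x_i and
    1 - d (t + sum of l_i x_i) generate the unit ideal modulo I.  That is
    phrased by quantifying over the ideals K which contain them, which avoids
    writing the coefficients of a linear combination. *)
Definition unimodular_shift (A : comPzRingType) n (I : ideal A) : Prop :=
  forall (u l : 'I_n -> A) (d t : A), exists x : 'I_n -> A,
  forall K : ideal A, (forall z, I z -> K z) ->
    (forall i, K (u i + d * d * x i)) ->
    K (1 - d * (t + \sum_i l i * x i)) -> K 1.

Lemma unimodular_shift_quotient (A : comPzRingType) n (I : ideal A) :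
  unimodular_shift n (principal (0 : quotient_ring I)) -> unimodular_shift n I.
Proof.
move=> H u l d t.
have [x Hx] := H (quotient_pi I \o u) (quotient_pi I \o l) (quotient_pi I d)
  (quotient_pi I t).
exists (repr \o x) => K IK Ku K1.
have [] := Hx (ideal_image I K).
- by move=> _ [a ->]; rewrite mulr0; apply: ideal0.
- move=> i; exists (u i + d * d * repr (x i)) => //.
  by rewrite rmorphD !rmorphM /= quotient_piK.
- eexists; first exact: K1.
  rewrite rmorphB rmorph1 rmorphM rmorphD rmorph_sum /=.
  congr (_ - _ * (_ + _)).
  by apply: eq_bigr => i _; rewrite rmorphM /= quotient_piK.
- move=> y Ky /quotient_piP /IK K1y.
  by rewrite -(subrK y 1); apply: idealD.
Qed.

(** Induction on n.  The coordinate [ord0] is sacrificed by passing to the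
    quotient by its boundary ideal. *)
Lemma Hdim_lt_shift (A : comPzRingType) n :
  Hdim_lt A n -> unimodular_shift n (principal (0 : A)).
Proof.
elim: n A => [|n IH] A /= HA u l d t.
  by exists u => K _ _ _; rewrite HA; apply: ideal0.
set v := u ord0.
have [x' Hx'] := unimodular_shift_quotient (IH _ (HA v))
  (fun i => u (lift ord0 i)) (fun i => l (lift ord0 i)) d t.
set t' := t + \sum_i l (lift ord0 i) * x' i in Hx' *.
pose G z := (exists i, z = u (lift ord0 i) + d * d * x' i) \/ z = 1 - d * t'.
(* The coordinate b found below must not depend on the ideal K of the
   conclusion, so the induction hypothesis is applied to the smallest possible
   ideal. *)
have [] := Hx' (ideal_sum (generated G) (heitmann v)).
- exact: ideal_sumWr.
- by move=> i; apply/ideal_sumWl/generatedW; left; exists i.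
- by apply/ideal_sumWl/generatedW; right.
move=> g Gg [a [b [Jb Eg]]].
exists (fun i => oapp x' b (unlift ord0 i)) => K _ Ku K1.
have Kv : K (v + d * d * b) by have := Ku ord0; rewrite unlift_none.
have {}Ku i : K (u (lift ord0 i) + d * d * x' i).
  by have := Ku (lift ord0 i); rewrite liftK.
have {}K1 : K (1 - d * (t' + l ord0 * b)).
  move: K1; rewrite big_ord_recl unlift_none /=.
  rewrite (eq_bigr (fun i => l (lift ord0 i) * x' i)) => [|i _].
    by rewrite addrA [t + _ + _]addrAC.
  by rewrite liftK.
(* It remains to show that 1 is in R, the radical of K: that is a semiprime
   ideal which contains K and the Jacobson radical of A. *)
apply/quotient_pi_eq0; rewrite rmorph1; apply: jacobson1.
pose R := ideal_preimage (jacobson (quotient_ring K)).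
have KR z : K z -> R z.
  by move=> /quotient_pi_eq0 Kz; rewrite /R /= Kz; apply: (ideal0 (jacobson _)).
have Rsqr z : R (z * z) -> R z by rewrite /R /= rmorphM; apply: jacobson_sqr.
have Rbv : R (b * v).
  exact: (@jacobson_surj _ _ (quotient_pi K)) (@quotient_pi_surj _ K) _ Jb.
have {}Kv := KR _ Kv; have {}K1 := KR _ K1.
have Rv : R v.
  apply: Rsqr; rewrite (_ : v * v = v * (v + d * d * b) - d * d * (b * v)).
    by apply: idealB; apply: idealM.
  by ring.
have Rdb : R (d * b).
  apply: Rsqr.
  rewrite (_ : d * b * (d * b) = b * (v + d * d * b) - b * v); last by ring.
  by apply: idealB => //; apply: idealM.
have Rt : R (1 - d * t').
  rewrite (_ : 1 - d * t' = 1 - d * (t' + l ord0 * b) + l ord0 * (d * b)).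
    by apply: idealD => //; apply: idealM.
  by ring.
have Rg : R g.
  by apply: (Gg R) => _ [[i ->]|->] //; apply: KR.
have Rb : R b.
  rewrite (_ : b = t' * (d * b) + b * (1 - d * t')); last by ring.
  by apply: idealD; apply: idealM.
rewrite -(rmorph1 (quotient_pi K)); change (R 1).
rewrite (_ : 1 = g + (v * a + b)); last by rewrite -Eg addrC subrK.
by apply: idealD => //; apply: idealD => //; apply: idealMr.
Qed.

(** * Splitting off a free summand *)

Definition linear_of (A : comPzRingType) (U V : lmodType A) (f : U -> V)
    (f_lin : linear f) : {linear U -> V} :=
  HB.pack f (GRing.isLinear.Build A U V *:%R f f_lin).

Section Kernel.
Variables (A : comPzRingType) (M : lmodType A) (f : {linear M -> A^o}).

Definition in_ker : {pred M} := [pred x | f x == 0].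

Lemma in_ker_submod : submod_closed in_ker.
Proof.
split=> [|a x y]; rewrite !inE ?raddf0 // => /eqP fx /eqP fy.
by rewrite linearP fx fy scaler0 addr0.
Qed.

HB.instance Definition _ :=
  GRing.isSubmodClosed.Build A M in_ker in_ker_submod.

Definition ker_mod : Type := {x : M | in_ker x}.
HB.instance Definition _ := SubType.on ker_mod.
HB.instance Definition _ := Choice.on ker_mod.
HB.instance Definition _ := [SubChoice_isSubLmodule of ker_mod by <:].

(** x = (x - f x m) + f x m. *)
Lemma split_off m : f m = 1 -> lmod_iso M (ker_mod * A^o)%type.
Proof.
move=> fm.
have kP x : in_ker (x - (f x : A) *: m).
  by rewrite /in_ker /= linearB linearZ_LR /= fm /GRing.scale /= mulr1 subrr.
pose F (x : M) : (ker_mod * A^o)%type := (Sub _ (kP x), f x).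
have F_lin : linear F.
  move=> a x y; congr (_, _); last by rewrite linearP.
  apply: val_inj; rewrite [RHS]linearP !SubK linearP.
  by rewrite scalerBr scalerDl opprD addrACA -scalerA.
exists (linear_of F_lin); exists (fun z => val z.1 + (z.2 : A) *: m).
  by move=> x /=; rewrite subrK.
case=> x a /=.
have fx : f (val x) = 0 by apply/eqP; apply: (valP x).
have fxa : f (val x + (a : A) *: m) = a.
  by rewrite linearD linearZ_LR /= fx fm add0r /GRing.scale /= mulr1.
by congr (_, _) => //; apply: val_inj; rewrite SubK fxa addrK.
Qed.

End Kernel.

(** * Unimodular elements of a module *)

(** Multiplication by w on A^k is a composite A^k -> M -> A^k, given by the m_j
    and the f_i; at a prime which does not contain w, this forces the rank of a
    finitely generated projective M to be at least k. *)
Definition scalar_factors (A : comPzRingType) (M : lmodType A) k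
    (w : A) : Prop :=
  exists (m : 'I_k -> M) (f : 'I_k -> {linear M -> A^o}),
    forall i j, f i (m j) = w *+ (i == j).

Section Unimodular.
Variables (A : comPzRingType) (M : lmodType A).

Lemma form_scale (f : {linear M -> A^o}) a x : f (a *: x) = a * f x.
Proof. exact: linearZ_LR. Qed.

Section Values.
Variables (m : M) (I : ideal A).
Let S (z : A) := exists f : {linear M -> A^o}, I (z - f m).

Let S0 : S 0.
Proof. by exists \0; rewrite subr0; apply: ideal0. Qed.
Let SD x y : S x -> S y -> S (x + y).
Proof.
move=> [f If] [g Ig]; exists (f \+ g) => /=.
by rewrite opprD addrACA; apply: idealD.
Qed.
Let SM a x : S x -> S (a * x).
Proof.
by move=> [f If]; exists (a \*: f); rewrite /= -mulrBr; apply: idealM.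
Qed.
Definition form_values : ideal A := Ideal S0 SD SM.

Lemma form_valuesW z : I z -> form_values z.
Proof. by move=> Iz; exists \0; rewrite subr0. Qed.
Lemma form_values_form (f : {linear M -> A^o}) : form_values (f m).
Proof. by exists f; rewrite subrr; apply: ideal0. Qed.
End Values.

(** m is moved along w times the vectors n_i which come with w.  The shift of
    the coordinate g_i (m) is then w^2 x_i, whereas f m only changes by a
    multiple of w, so that it keeps the form 1 - w t' modulo I. *)
Lemma unimodular_mod_drop k (I : ideal A) (w a : A) (m : M)
    (f : {linear M -> A^o}) :
    unimodular_shift k I -> scalar_factors M k w ->
    I (1 - f m - a * w) ->
  exists (m' : M) (f' : {linear M -> A^o}), I (1 - f' m').
Proof.
move=> shift [n [g gn]] Ifm.
have [x Hx] := shift (fun i => g i m) (fun i => - f (n i)) w a.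
pose m' := m + \sum_i (w * x i) *: n i; exists m'.
have formE (h : {linear M -> A^o}) : h m' = h m + \sum_i w * x i * h (n i).
  rewrite linearD linear_sum; congr (_ + _).
  by apply: eq_bigr => i _; rewrite form_scale.
apply: (Hx (form_values m' I)).
- exact: form_valuesW.
- move=> i; rewrite (_ : _ + _ = g i m'); first exact: form_values_form.
  rewrite formE; congr (_ + _); rewrite (bigD1 i) //= gn eqxx big1 => [|j ji].
    by rewrite addr0 mulr1n mulrAC.
  by rewrite gn eq_sym (negbTE ji) mulr0.
- rewrite (_ : 1 - _ = f m' + (1 - f m - a * w)).
    by apply: idealD; [apply: form_values_form | apply: form_valuesW].
  have -> : \sum_i - f (n i) * x i = - \sum_i x i * f (n i).
    by rewrite -sumrN; apply: eq_bigr => i _; rewrite mulNr mulrC.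
  have -> : f m' = f m + w * \sum_i x i * f (n i).
    by rewrite formE mulr_sumr; under eq_bigr do rewrite -mulrA.
  have E (y z : A) : 1 - w * (a - z) = y + w * z + (1 - y - a * w) by ring.
  exact: E.
Qed.

(** Starting from 1 = 0 + sum of ws, the w's are removed one by one, working
    modulo the ideal generated by those that are left. *)
Lemma unimodular_exists k (ws : seq A) : Hdim_lt A k ->
    (forall w, w \in ws -> scalar_factors M k w) -> \sum_(w <- ws) w = 1 ->
  exists (m : M) (f : {linear M -> A^o}), f m = 1.
Proof.
move=> HA Hws sum1.
pose span (s : seq A) := generated (fun x => x \in s).
suff [m [f]] : exists (m : M) (f : {linear M -> A^o}), span [::] (1 - f m).
  case/(_ (principal 0)) => // a; rewrite mulr0 => /subr0_eq f1.
  by exists m, f.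
have : exists (m : M) (f : {linear M -> A^o}), span ws (1 - f m).
  exists 0, \0; rewrite subr0 -sum1 big_seq.
  apply: (big_ind (ideal_set (span ws))) => [|x y|w w_ws].
  - exact: ideal0.
  - exact: idealD.
  - exact: (@generatedW _ (fun x => x \in ws)).
elim: ws Hws {sum1} => // w ws IH Hws [m [f fm]].
apply: IH => [v vws|]; first by apply: Hws; rewrite inE vws orbT.
have [|y Iy [a fmy]] := fm (ideal_sum (span ws) (principal w)).
  move=> v; rewrite inE => /predU1P[->|vws].
    exact/ideal_sumWr/principal_gen.
  exact/ideal_sumWl/generatedW.
apply: (@unimodular_mod_drop k _ w a m f).
- exact/unimodular_shift_quotient/Hdim_lt_shift/Hdim_lt_quotient.
- by apply: Hws; rewrite inE eqxx.
- by rewrite -fmy subKr.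
Qed.

End Unimodular.

Lemma scalar_factorsW (A : comPzRingType) (M : lmodType A) k r (w : A) :
  (k <= r)%N -> scalar_factors M r w -> scalar_factors M k w.
Proof.
move=> kr [m [f fm]].
exists (m \o widen_ord kr), (f \o widen_ord kr) => i j /=.
by rewrite fm.
Qed.

Lemma scalar_factorsM (A : comPzRingType) (M : lmodType A) k (a w : A) :
  scalar_factors M k w -> scalar_factors M k (a * w).
Proof.
move=> [m [f fm]]; exists (fun j => a *: m j), f => i j.
by rewrite form_scale fm mulrnAr.
Qed.

(** * Prime ideals *)

Section Primes.
Variable A : comPzRingType.

(** An ideal maximal among the proper ideals containing I is prime. *)
Lemma prime_above (I : ideal A) : ~ I 1 ->
  exists p : prime_ideal A, forall x, I x -> p x.
Proof.
move=> I1.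
pose P (S : set A) := exists2 J : ideal A,
  forall x, J x <-> S x \/ I x & ~ J 1.
(* Adding I to the set makes the empty chain harmless: its union is empty. *)
have [|S [[J JE J1] Smax]] := @Zorn_bigcup A P.
  move=> F FP Ftot.
  pose T x := (exists2 S, F S & S x) \/ I x.
  have T0 : T 0 by right; apply: ideal0.
  have TD x y : T x -> T y -> T (x + y).
    have TS S u v : F S -> S u \/ I u -> S v \/ I v -> T (u + v).
      move=> FS Su Sv; have [J JE _] := FP _ FS.
      have /JE[Suv|Iuv] : J (u + v) by apply: idealD; apply/JE.
        by left; exists S.
      by right.
    case=> [[S FS Sx]|Ix] [[S' FS' Sy]|Iy].
    - have [SS'|S'S] := Ftot _ _ FS FS'.
        by apply: (TS S') => //; left => //; apply: SS'.
      by apply: (TS S) => //; left => //; apply: S'S.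
    - by apply: (TS S) => //; [left|right].
    - by apply: (TS S') => //; [right|left].
    - by right; apply: idealD.
  have TM a x : T x -> T (a * x).
    case=> [[S FS Sx]|Ix]; last by right; apply: idealM.
    have [J JE _] := FP _ FS.
    have /JE[Sax|Iax] : J (a * x) by apply/idealM/JE; left.
      by left; exists S.
    by right.
  exists (Ideal T0 TD TM) => [x|] //=.
  case=> [[S FS S1]|//]; have [J JE J1] := FP _ FS.
  by apply/J1/JE; left.
suff Jprime x y : J (x * y) -> J x \/ J y.
  by exists (PrimeIdeal J1 Jprime) => x Ix; apply/JE; right.
move=> Jxy; apply: contrapT => /not_orP[Jx Jy].
pose Q := ideal_sum J (principal x).
have [z Jz [a za]] : Q 1.
  apply: contrapT => Q1; apply: (Smax Q); last first.
    exists Q => // z; split=> [|[//|Iz]]; first by left.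
    by apply/ideal_sumWl/JE; right.
  split=> [z Sz|SQ]; first by apply/ideal_sumWl/JE; left.
  apply: Jx; apply/JE; left; apply: SQ.
  exact/ideal_sumWr/principal_gen.
apply: Jy; rewrite (_ : y = z * y + a * (x * y)).
  by apply: idealD; [apply: idealMr | apply: idealM].
by rewrite mulrA -za; ring.
Qed.

(** Finitely many conditions, each met by some element outside p and stable
    under multiples, are met simultaneously: take the product. *)
Lemma common_multiple (p : prime_ideal A) (T : finType) (P : T -> A -> Prop) :
    (forall i, exists2 s, ~ p s & P i s) ->
    (forall i a s, P i s -> P i (a * s)) ->
  exists2 s, ~ p s & forall i, P i s.
Proof.
move=> Pex Pmul.
have /choice[s Hs] : forall i, exists s, ~ p s /\ P i s.
  by move=> i; have [s] := Pex i; exists s.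
exists (\prod_i s i) => [|i].
  apply: (big_ind (fun x => ~ p x)) => [|x y px py /prime_idealM[]//|i _].
    exact: prime_ideal1.
  by have [] := Hs i.
by rewrite (bigD1 i) //= mulrC; apply: Pmul; have [] := Hs i.
Qed.

End Primes.

(** * Localization *)

Section LocalRank.
Variables (A : comPzRingType) (p : prime_ideal A).
Local Notation R := (loc_ring p).

Section Embedding.
Variable M : lmodType A.

Definition loc_embed (x : M) : localized p M := loc_frac x (denom1 p).

Lemma loc_embedD : {morph loc_embed : x y / x + y}.
Proof.
move=> x y; rewrite loc_fracD; apply/loc_fracP; exists (denom1 p).
by rewrite !denM !den1 mulr1 !scale1r.
Qed.

Lemma loc_embed0 : loc_embed 0 = 0.
Proof. by []. Qed.

Lemma loc_embed_inj x y : loc_embed x = loc_embed y ->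
  exists2 u, ~ p u & u *: x = u *: y.
Proof.
move=> /loc_fracP[u]; rewrite !den1 !scale1r => Hu.
by exists (den u) => //; apply: denomP.
Qed.

End Embedding.

Definition loc_const (a : A) : R := @loc_embed A^o a.

Lemma loc_constZ (M : lmodType A) a (x : M) :
  loc_const a *: loc_embed x = loc_embed (a *: x).
Proof.
rewrite [LHS]loc_frac_act; apply/loc_fracP; exists (denom1 p).
by rewrite !denM !den1 mulr1.
Qed.

Lemma loc_constM : {morph loc_const : a b / a * b}.
Proof. by move=> a b; symmetry; apply: (@loc_constZ A^o). Qed.

Lemma loc_constD : {morph loc_const : a b / a + b}.
Proof. exact: (@loc_embedD A^o). Qed.

Lemma loc_clear (M : lmodType A) (z : localized p M) :
  exists2 s, ~ p s & exists x, loc_const s *: z = loc_embed x.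
Proof.
elim/loc_fracW: z => x s; exists (den s); first exact: denomP.
exists x; rewrite [LHS]loc_frac_act; apply/loc_fracP; exists (denom1 p).
by rewrite !denM !den1 mul1r !scale1r.
Qed.

(** Let phi be an isomorphism from (A_p)^r to M_p, with inverse psi.  Since M is
    finitely generated and projective, with coordinate forms h_i dual to the
    generators g_i, the linear map psi is determined by finitely many fractions
    psi (g_i); a common denominator d turns its components into forms f_j on M.
    Similarly s clears the denominators of the phi (e_i), which gives elements
    m_i of M.  The identities f_j (m_i) = d s if i = j, and 0 otherwise, hold
    in A_p, hence in A after multiplication by a further u. *)
Lemma scalar_factors_localized (M : lmodType A) r :
    finitely_generated M -> projective M -> has_rank_at p M r ->
  exists2 w, ~ p w & scalar_factors M r w.
Proof.
move=> [n [g gspan]] projM [phi [psi phiK psiK]].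
pose gsum (c : 'rV[A]_n) : M := \sum_i c 0 i *: g i.
have gsum_lin : linear gsum.
  move=> a b c; rewrite /gsum scaler_sumr -big_split /=.
  by apply: eq_bigr => i _; rewrite !mxE scalerDl scalerA.
have [v|h hK] := projM _ _ (linear_of gsum_lin) (idfun : {linear M -> M}).
  have [c ->] := gspan v; exists (\row_i c i) => /=.
  by apply: eq_bigr => i _; rewrite mxE.
have psi_lin : linear psi := GRing.can2_linear phiK psiK.
pose psiL : {linear localized p M -> 'rV[R]_r} :=
  HB.pack psi (GRing.isLinear.Build R _ _ *:%R psi psi_lin).
pose coef x (j : 'I_r) : R := psiL (loc_embed x) 0 j.
have [d pd /choice[c Hc]] : exists2 d, ~ p d &
    forall ij : 'I_n * 'I_r,
      exists c, loc_const d * coef (g ij.1) ij.2 = loc_const c.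
  apply: common_multiple => [ij|ij a s [c Hc]]; first exact: (@loc_clear A^o).
  by exists (a * c); rewrite !loc_constM -mulrA Hc.
pose f j (x : M) : A^o := \sum_i h x 0 i * c (i, j).
have f_lin j : linear (f j).
  move=> a x y; rewrite /f scaler_sumr -big_split /=; apply: eq_bigr => i _.
  by rewrite linearP !mxE mulrDl -mulrA.
have fE j x : loc_const (f j x) = loc_const d * coef x j.
  rewrite /f (big_morph loc_const loc_constD (loc_embed0 _)).
  have gh : gsum (h x) = x by exact: hK.
  rewrite /coef -[in RHS]gh /gsum (big_morph _ (@loc_embedD M) (@loc_embed0 M)).
  rewrite linear_sum summxE mulr_sumr; apply: eq_bigr => i _.
  by rewrite -loc_constZ linearZ mxE loc_constM -(Hc (i, j)) mulrCA.
have [s ps /choice[m Hm]] : exists2 s, ~ p s & forall i : 'I_r,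
    exists x, loc_const s *: phi (delta_mx 0 i) = loc_embed x.
  apply: common_multiple => [i|i a s [x Hx]]; first exact: loc_clear.
  by exists (a *: x); rewrite loc_constM -scalerA Hx loc_constZ.
have [u pu Hu] : exists2 u, ~ p u & forall ij : 'I_r * 'I_r,
    u * f ij.1 (m ij.2) = u * (d * s *+ (ij.1 == ij.2)).
  apply: common_multiple => [[i j]|ij a u Hu]; last by rewrite -!mulrA Hu.
  apply: (@loc_embed_inj A^o); rewrite -[LHS]/(loc_const _) fE /coef -Hm.
  rewrite linearZ /= phiK !mxE eqxx /= eq_sym.
  case: eqP => _; last by rewrite !mulr0.
  by rewrite mulr1 -loc_constM.
exists (u * (d * s)); first by do 2![move=> /prime_idealM[]//].
exists (fun j => u *: m j), (fun j => linear_of (f_lin j)) => i j.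
by rewrite linearZ_LR /= [LHS](Hu (i, j)) mulrnAr.
Qed.

End LocalRank.

(** * The splitting theorem *)

(** The sums of scalars that factor form an ideal, contained in no prime. *)
Lemma scalar_factors_sum1 (A : comPzRingType) (M : lmodType A) k :
    finitely_generated M -> projective M -> rank_ge M k ->
  exists2 ws : seq A, forall w, w \in ws -> scalar_factors M k w &
                      \sum_(w <- ws) w = 1.
Proof.
move=> fgM projM rankM.
pose S (x : A) := exists2 ws : seq A,
  forall w, w \in ws -> scalar_factors M k w & \sum_(w <- ws) w = x.
have S0 : S 0 by exists [::] => //; rewrite big_nil.
have SD x y : S x -> S y -> S (x + y).
  move=> [s Hs <-] [t Ht <-]; exists (s ++ t); last by rewrite big_cat.
  by move=> w; rewrite mem_cat => /orP[/Hs|/Ht].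
have SM a x : S x -> S (a * x).
  move=> [s Hs <-]; exists [seq a * w | w <- s].
    by move=> _ /mapP[w /Hs Hw ->]; apply: scalar_factorsM.
  by rewrite big_map mulr_sumr.
apply: contrapT => /(@prime_above _ (Ideal S0 SD SM))[p Sp].
have [r rk kr] := rankM p.
have [w pw Hw] := scalar_factors_localized fgM projM rk.
apply/pw/Sp; exists [:: w]; last by rewrite big_seq1.
by move=> _ /[!inE] /eqP ->; apply: scalar_factorsW Hw.
Qed.

Theorem mainTheorem6 (A : comPzRingType) (k : nat) (M : lmodType A)
    (hdimA : Hdim_lt A k) (fgM : finitely_generated M) (projM : projective M)
    (rankM : rank_ge M k) :
  exists N : lmodType A, lmod_iso M (N * A^o)%type.
Proof.
have [ws Hws sum1] := scalar_factors_sum1 fgM projM rankM.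
have [m [f fm1]] := unimodular_exists hdimA Hws sum1.
by exists (ker_mod f); apply: split_off fm1.
Qed.
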